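(* Let $G=(V,E)$ be a signed graph with no three distinct, pairwise non-adjacent vertices (i.e. the independence number $\alpha(G)$ is less than three). Then $G$ is signed-eliminable if and only if all of the following three conditions hold: (C2) For every $\sigma\in\{+,-\}$ and every four distinct vertices $u,v,w,x$ of $G$ with $uv\in E_\sigma$, $vw\in E_{-\sigma}$, $wx\in E_\sigma$, we have either ($uw\in E_\sigma$ and $ux\in E_\sigma$) or ($ux\in E_\sigma$ and $vx\in E_\sigma$). (I1) Neither $G_+$ nor $G_-$ has a cycle of length four or five which is an induced cycle in $G$. (I2) $G$ contains no hill with five or six vertices as an induced subgraph.
   Context: All graphs are finite, simple and undirected. A signed graph is a graph $G=(V,E)$ together with a partition $E=E_+\sqcup E_-$ (either part may be empty); put $G_\sigma=(V,E_\sigma)$ for $\sigma\in\{+,-\}$, and let $-\sigma$ be the opposite sign. Induced subgraphs of a signed graph inherit the signs. An ordering on $G$ is a bijection $\nu:V\to\{1,\dots,|V|\}$. It is a signed elimination ordering (SEO) if for every triple $(u,v,w)$ of distinct vertices with $\nu(u)<\nu(w)>\nu(v)$ and each $\sigma\in\{+,-\}$: (E1) if $uw,wv\in E_\sigma$ then $uv\in E_\sigma$; (E2) if $uv\in E_\sigma$ and $vw\in E_{-\sigma}$ then $uw\in E_\sigma$. $G$ is signed-eliminable if it admits a SEO. A hill is a signed graph for which there are $\sigma\in\{+,-\}$ and an enumeration $(v_1,\dots,v_n;w_1,w_2)$ of its (distinct) vertices, $n\ge 2$, such that $v_iv_{i+1}\in E_{-\sigma}$ for $1\le i\le n-1$,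 $w_1w_2\in E_\sigma$, $w_1v_i\in E_\sigma$ for $1\le i\le n-1$, $w_2v_i\in E_\sigma$ for $2\le i\le n$, and no other pair of vertices is joined by an edge. *)

(* Defs.v *)
From mathcomp Require Import all_boot.

Set Implicit Arguments.
Unset Strict Implicit.
Unset Printing Implicit Defensive.

(* Signs are booleans ([true] is +, [~~ s] is the opposite sign), so that
   [sedge G s] is the edge relation of the graph G_s.  The underlying graph is
   recovered as the disjoint union [adj] of its two parts. *)
Record signed_graph (V : finType) : Type := SignedGraph {
  sedge : bool -> rel V;
  sedge_sym : forall s, symmetric (sedge s);
  sedge_irr : forall s, irreflexive (sedge s);
  sedge_disj : forall x y, ~~ (sedge true x y && sedge false x y)
}.

Definition adj (V : finType) (G : signed_graph V) : rel V :=
  fun x y => sedge G true x y || sedge G false x y.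

Section Induced.

Variables (V : finType) (G : signed_graph V) (S : {set V}).

Definition induced_edge (s : bool) : rel {x : V | x \in S} :=
  fun x y => sedge G s (val x) (val y).

Lemma induced_edge_sym s : symmetric (induced_edge s).
Proof. by move=> x y; apply: sedge_sym. Qed.

Lemma induced_edge_irr s : irreflexive (induced_edge s).
Proof. by move=> x; apply: sedge_irr. Qed.

Lemma induced_edge_disj x y :
  ~~ (induced_edge true x y && induced_edge false x y).
Proof. exact: sedge_disj. Qed.

Definition induced : signed_graph {x : V | x \in S} :=
  SignedGraph induced_edge_sym induced_edge_irr induced_edge_disj.

End Induced.

Section SignedGraphs.

Variables (V : finType) (G : signed_graph V).

(* Positions are numbered from 0 instead of 1; only their order matters. *)
Definition is_SEO (nu : V -> 'I_#|V|) : Prop :=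
  bijective nu /\
  forall u v w : V, uniq [:: u; v; w] -> nu u < nu w -> nu v < nu w ->
  forall s : bool,
    (sedge G s u w -> sedge G s w v -> sedge G s u v) /\
    (sedge G s u v -> sedge G (~~ s) v w -> sedge G s u w).

Definition signed_eliminable : Prop := exists nu : V -> 'I_#|V|, is_SEO nu.

Definition no_independent_triple : Prop :=
  ~ exists x y z : V,
      [/\ uniq [:: x; y; z], ~~ adj G x y, ~~ adj G y z & ~~ adj G x z].

Definition cond_C2 : Prop :=
  forall (s : bool) (u v w x : V), uniq [:: u; v; w; x] ->
    sedge G s u v -> sedge G (~~ s) v w -> sedge G s w x ->
    (sedge G s u w /\ sedge G s u x) \/ (sedge G s u x /\ sedge G s v x).

(* The vertices of [c] form, in this cyclic order, a cycle of G_s, and no two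
   of them are joined in G by an edge of either sign outside the cycle. *)
Definition induced_signed_cycle (s : bool) (c : seq V) : Prop :=
  [/\ 3 <= size c, uniq c, cycle (sedge G s) c
    & forall x y, x \in c -> y \in c -> adj G x y ->
        y = next c x \/ x = next c y].

Definition cond_I1 : Prop :=
  forall (s : bool) (c : seq V),
    size c = 4 \/ size c = 5 -> ~ induced_signed_cycle s c.

(* The vertices v_1, ..., v_n are v 0, ..., v (n - 1). *)
Definition is_hill : Prop :=
  exists (s : bool) (n : nat) (v : 'I_n -> V) (w1 w2 : V),
    [/\ 2 <= n,
        uniq [:: w1, w2 & [seq v i | i <- enum 'I_n]]
          /\ (forall x : V, x \in [:: w1, w2 & [seq v i | i <- enum 'I_n]]),
        [/\ forall i j : 'I_n, j = i.+1 :> nat -> sedge G (~~ s) (v i) (v j),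
            sedge G s w1 w2,
            forall i : 'I_n, i.+1 < n -> sedge G s w1 (v i)
          & forall i : 'I_n, 0 < i -> sedge G s w2 (v i)]
      & [/\ forall i j : 'I_n, i.+1 < j -> ~~ adj G (v i) (v j),
            forall i : 'I_n, i.+1 = n -> ~~ adj G w1 (v i)
          & forall i : 'I_n, i = 0 :> nat -> ~~ adj G w2 (v i)]].

End SignedGraphs.

Definition cond_I2 (V : finType) (G : signed_graph V) : Prop :=
  forall S : {set V}, #|S| = 5 \/ #|S| = 6 -> ~ is_hill (induced G S).

(* Main.v *)
(* Eliminability is hereditary, and it fails on the listed obstructions because
   none of their vertices can come last.  Conversely it suffices to find, in a
   nonempty graph avoiding the obstructions, one vertex that can come last.

   By (C2) the s-neighbourhoods of the two ends of a (-s)-edge are nested; say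
   that the end with the strictly larger one beats the other.  This relation is
   acyclic enough to admit unbeaten vertices, and an unbeaten vertex w can come
   last unless it has nonadjacent neighbours u, u' of the same sign s.  In that
   case (C2), (I1) and alpha < 3 force, up to exchanging u and u', that every
   non-neighbour of w is s-joined to u and not adjacent to u'.  Take w unbeaten
   with minimal closed neighbourhood.  Then u' is beaten, since its closed
   neighbourhood is smaller, and by (I2) every (-s)-neighbour of w is
   (-s)-joined to all non-neighbours of w.  These therefore form a nonempty set
   containing whatever beats its members, and an unbeaten vertex of that set
   with minimal closed neighbourhood can come last. *)

Require Import Defs.
From mathcomp Require Import all_boot.

Set Implicit Arguments.
Unset Strict Implicit.
Unset Printing Implicit Defensive.

(** * Edges and their signs *)

Section Edges.

Variables (V : finType) (G : signed_graph V).
Local Notation e := (sedge G).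

Lemma sedge_opp s x y : e s x y -> e (~~ s) x y = false.
Proof.
move=> exy; apply/negP=> exy'; have := sedge_disj G x y.
by case: s exy exy' => /= -> ->.
Qed.

Lemma sedge_neq s x y : e s x y -> x != y.
Proof. by apply: contraTneq => ->; rewrite sedge_irr. Qed.

Lemma adjE s x y : adj G x y = e s x y || e (~~ s) x y.
Proof. by case: s; rewrite /adj // orbC. Qed.

Lemma sedge_adj s x y : e s x y -> adj G x y.
Proof. by rewrite (adjE s) => ->. Qed.

Lemma adj_sym : symmetric (adj G).
Proof. by move=> x y; rewrite /adj !(sedge_sym _ _ x). Qed.

Lemma adj_irr : irreflexive (adj G).
Proof. by move=> x; rewrite /adj !sedge_irr. Qed.

Lemma sedge_opp_neq s x y z : e s x z -> e (~~ s) y z -> x != y.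
Proof. by move=> /sedge_opp h; apply: contraTneq => <-; rewrite h. Qed.

End Edges.

(** * Obstructions as forced adjacencies *)

(** In the cycles and hills, distinctness follows from the edges and the nonadjacencies, except for
    opposite vertices of the four-cycle. *)
Record obstruction_free (V : finType) (G : signed_graph V) : Prop :=
  ObstructionFree {
  free_alpha : forall x y z, x != y -> y != z -> x != z ->
    ~~ adj G x y -> ~~ adj G y z -> adj G x z;
  free_C2 : cond_C2 G;
  free_cycle4 : forall s a b c d, a != c -> b != d ->
    sedge G s a b -> sedge G s b c -> sedge G s c d -> sedge G s d a ->
    adj G a c || adj G b d;
  free_cycle5 : forall s a b c d f,
    sedge G s a b -> sedge G s b c -> sedge G s c d -> sedge G s d f ->
    sedge G s f a ->
    [|| adj G a c, adj G a d, adj G b d, adj G b f | adj G c f];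
  free_hill5 : forall s v1 v2 v3 w1 w2,
    sedge G (~~ s) v1 v2 -> sedge G (~~ s) v2 v3 -> sedge G s w1 w2 ->
    sedge G s w1 v1 -> sedge G s w1 v2 ->
    sedge G s w2 v2 -> sedge G s w2 v3 ->
    [|| adj G v1 v3, adj G w1 v3 | adj G w2 v1];
  free_hill6 : forall s v1 v2 v3 v4 w1 w2,
    sedge G (~~ s) v1 v2 -> sedge G (~~ s) v2 v3 -> sedge G (~~ s) v3 v4 ->
    sedge G s w1 w2 ->
    sedge G s w1 v1 -> sedge G s w1 v2 -> sedge G s w1 v3 ->
    sedge G s w2 v2 -> sedge G s w2 v3 -> sedge G s w2 v4 ->
    [|| adj G v1 v3, adj G v1 v4, adj G v2 v4, adj G w1 v4 | adj G w2 v1]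
}.

(** (E1) and (E2) for [w] placed after all other vertices; [v != w] follows from the premises. *)
Definition signed_simplicial (V : finType) (G : signed_graph V) (w : V) :=
  forall (s : bool) (u v : V), u != v -> u != w ->
    (sedge G s u w -> sedge G s w v -> sedge G s u v) /\
    (sedge G s u v -> sedge G (~~ s) v w -> sedge G s u w).

(** * Consequences of (C2) and the beating relation *)

Section Simplicial.

Variables (V : finType) (G : signed_graph V).
Hypothesis freeG : obstruction_free G.
Local Notation e := (sedge G).

(** Both alternatives of (C2) contain the edge [ux]. The signs at [v] and at [w] already separate
    [u] from [w] and [v] from [x]. *)
Lemma C2_path s u v w x :
  e s u v -> e (~~ s) v w -> e s w x -> u != x ->
  e s u x /\ (e s u w \/ e s v x).
Proof.
move=> uv vw wx ux.
have uw : u != w by apply: sedge_opp_neq uv _; rewrite sedge_sym.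
have vx : v != x.
  apply: contraTneq wx => <-; rewrite sedge_sym -{1}(negbK s).
  by rewrite (sedge_opp vw).
have uniq4 : uniq [:: u; v; w; x].
  by rewrite /= !inE !negb_or (sedge_neq uv) uw ux (sedge_neq vw) vx (sedge_neq wx).
by case: (free_C2 freeG uniq4 uv vw wx) => -[]; split; auto.
Qed.

(** Only non-inclusion of the s-neighbourhoods is recorded; the opposite inclusion is supplied by
    (C2) in [beaten_nested]. *)
Definition beaten s x y := e (~~ s) x y && [exists z, e s y z && ~~ e s x z].

Definition unbeaten x := [forall s, forall y, ~~ beaten s x y].

Lemma beatenP s x y :
  reflect (e (~~ s) x y /\ exists2 z, e s y z & ~~ e s x z) (beaten s x y).
Proof.
apply: (iffP andP) => [[xy /existsP[z /andP[]]]|[xy [z yz xz]]].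
  by split=> //; exists z.
by split=> //; apply/existsP; exists z; rewrite yz.
Qed.

Lemma unbeatenP x :
  reflect (forall s y z, e (~~ s) x y -> e s y z -> e s x z) (unbeaten x).
Proof.
apply: (iffP forallP) => [h s y z xy yz|h s].
  move/forallP/(_ y): (h s); apply: contraNT => xz.
  by apply/beatenP; split=> //; exists z.
by apply/forallP=> y; apply/beatenP => -[xy [z yz /negP]]; apply; apply: h yz.
Qed.

Lemma unbeatenNP x : ~~ unbeaten x -> exists s y, beaten s x y.
Proof.
by rewrite negb_forall => /existsP[s]; rewrite negb_forall => /existsP[y /negbNE];
  exists s, y.
Qed.

Lemma beaten_nested s x y z : beaten s x y -> e s x z -> e s y z.
Proof.
case/beatenP=> xy [t yt xt] xz; have zx : e s z x by rewrite sedge_sym.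
have zt : z != t by apply: contraTneq xz => ->.
by case: (C2_path zx xy yt zt) => _ []; [rewrite sedge_sym | rewrite (negPf xt)].
Qed.

(** Nestedness for the sign -s makes [xz] a (-s)-edge. The witness is [y], which is s-joined to [z]
    and (-s)-joined to [x]. *)
Lemma beaten_opp s x y z : beaten s x y -> beaten (~~ s) y z -> beaten s x z.
Proof.
case/beatenP=> xy _ yz; apply/beatenP.
have zx : e (~~ s) z x by apply: (beaten_nested yz); rewrite sedge_sym.
split; first by rewrite sedge_sym.
exists y; last by rewrite -{1}(negbK s) (sedge_opp xy).
by case/beatenP: yz; rewrite negbK sedge_sym.
Qed.

Lemma beaten_card s x y :
  beaten s x y -> #|[set z | e s x z]| < #|[set z | e s y z]|.
Proof.
move=> xy; apply/proper_card/properP; split.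
  by apply/subsetP=> z; rewrite !inE; apply: beaten_nested.
by case/beatenP: xy => _ [z yz xz]; exists z; rewrite inE.
Qed.

(** Beating strictly increases the s-degree, so a member of [D] of maximal s-degree works. *)
Lemma unbeaten_sign_exists s (D : pred V) x0 : D x0 ->
    (forall x y, D x -> beaten s x y -> D y) ->
  exists2 x, D x & forall y, ~~ beaten s x y.
Proof.
move=> Dx0 up; case: (arg_maxnP (fun x => #|[set z | e s x z]|) Dx0) => x Dx maxx.
exists x => // y; apply/negP=> xy.
by have := maxx y (up x y Dx xy); rewrite /= leqNgt beaten_card.
Qed.

(** Among the members of [D] unbeaten for [true], one of maximal [false]-degree works. If it were
    beaten for [false], its beaters in [D] would be closed under [true]-beating by [beaten_opp], so
    one of them would be unbeaten for [true] and have larger [false]-degree. *)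
Lemma unbeaten_exists (D : pred V) x0 : D x0 ->
    (forall s x y, D x -> beaten s x y -> D y) ->
  exists2 x, D x & unbeaten x.
Proof.
move=> Dx0 up.
have [x1 Dx1 x1top] := unbeaten_sign_exists Dx0 (up true).
pose D1 := [pred x | D x & [forall y, ~~ beaten true x y]].
have D1x1 : D1 x1 by rewrite /= Dx1; apply/forallP.
case: (arg_maxnP (fun x => #|[set z | e false x z]|) D1x1).
move=> x /= /andP[Dx xtop] maxx; exists x => //.
apply: contraT => /unbeatenNP[[] [y xy]]; first by have := forallP xtop y; rewrite xy.
pose D2 := [pred z | D z & beaten false x z].
have [||z /= /andP[Dz xz] ztop] := @unbeaten_sign_exists true D2 y.
- by rewrite /= xy (up _ _ _ Dx xy).
- move=> a b /= /andP[Da xa] ab; rewrite (up _ _ _ Da ab).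
  exact: beaten_opp xa ab.
have : #|[set a | e false z a]| <= #|[set a | e false x a]|.
  by apply: maxx; rewrite Dz; apply/forallP.
by rewrite leqNgt beaten_card.
Qed.

(** This is (E2) at [w]. *)
Lemma unbeaten_closed w t y z :
  unbeaten w -> e t w y -> e (~~ t) y z -> e (~~ t) w z.
Proof. by move=> /unbeatenP top wy yz; apply: top yz; rewrite negbK. Qed.

Lemma unbeaten_far_edge w t a c :
  unbeaten w -> e t w a -> ~~ adj G w c -> adj G a c -> e t a c.
Proof.
move=> top wa wc; rewrite (adjE _ t) => /orP[//|].
by move=> /(unbeaten_closed top wa)/sedge_adj; rewrite (negPf wc).
Qed.

Lemma nonadj3 x y z : x != y -> y != z -> x != z ->
  ~~ adj G x y -> ~~ adj G y z -> ~~ adj G x z -> False.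
Proof. by move=> xy yz xz nxy nyz /negP; apply; exact: (free_alpha freeG) nxy nyz. Qed.

(** * Nonadjacent neighbours of the same sign *)

Definition blocking s w u u' :=
  [/\ e s w u, e s w u', u != u' & ~~ adj G u u'].

Lemma blocking_sym s w u u' : blocking s w u u' -> blocking s w u' u.
Proof. by case=> *; split; rewrite 1?eq_sym 1?adj_sym. Qed.

(** Otherwise (C2) along [u], [b], [w], [u'] would make [u] and [u'] adjacent. *)
Lemma blocking_opp s w u u' b : blocking s w u u' -> e (~~ s) w b -> ~~ e s u b.
Proof.
case=> wu wu' neq_uu' uu' wb; apply: contra uu' => ub.
have bw : e (~~ s) b w by rewrite sedge_sym.
by have [/sedge_adj] := C2_path ub bw wu' neq_uu'.
Qed.

Lemma blocking_adj_opp s w u u' b :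
  blocking s w u u' -> e (~~ s) w b -> adj G u b = e (~~ s) u b.
Proof. by move=> bl wb; rewrite (adjE _ s) (negPf (blocking_opp bl wb)). Qed.

Lemma blocking_cover s w u u' b : blocking s w u u' -> e (~~ s) w b ->
  e (~~ s) u b || e (~~ s) u' b.
Proof.
move=> bl wb; have bl' := blocking_sym bl.
rewrite -(blocking_adj_opp bl wb) -(blocking_adj_opp bl' wb).
case: bl => wu wu' neq_uu' uu'; apply: contraT.
rewrite negb_or => /andP[ub u'b]; exfalso.
have bw : e (~~ s) b w by rewrite sedge_sym.
have ne v : e s w v -> b != v.
  by move=> wv; rewrite eq_sym; apply: (@sedge_opp_neq _ G s _ _ w); rewrite sedge_sym.
by apply: (@nonadj3 u b u'); rewrite // ?ne // 1?eq_sym ?ne // adj_sym.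
Qed.

(* Two neighbours witnessing incomparability would complete u, w, u' to a hill
   with five vertices. *)
Lemma blocking_nested s w u u' : blocking s w u u' ->
  (forall b, e (~~ s) w b -> e (~~ s) u b) \/
  (forall b, e (~~ s) w b -> e (~~ s) u' b).
Proof.
move=> bl; have bl' := blocking_sym bl.
have [/forallP h|] := boolP [forall b, e (~~ s) w b ==> e (~~ s) u b].
  by left=> b; apply/implyP.
have [/forallP h|] := boolP [forall b, e (~~ s) w b ==> e (~~ s) u' b].
  by right=> b; apply/implyP.
rewrite !negb_forall => /existsP[b']; rewrite negb_imply => /andP[wb' u'b'].
move=> /existsP[b]; rewrite negb_imply => /andP[wb ub]; exfalso.
have ub' : e (~~ s) u b'.
  by move: (blocking_cover bl wb'); rewrite (negPf u'b') orbF.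
have u'b : e (~~ s) u' b by move: (blocking_cover bl wb); rewrite (negPf ub).
move: (bl) => [wu wu' neq_uu' uu'].
have bb' : b != b' by apply: contraNneq ub => ->.
have bu' : e (~~ s) b u' by rewrite sedge_sym.
have u'w : e (~~ ~~ s) u' w by rewrite negbK sedge_sym.
(* (C2) along [b], [u'], [w], [b'] gives the edge [w1 w2] of the hill, whose path is [u], [w],
   [u']. *)
have [bb'_edge _] := C2_path bu' u'w wb' bb'.
have uw : e s u w by rewrite sedge_sym.
have := @free_hill5 _ _ freeG (~~ s) u w u' b' b.
rewrite negbK uw wu' (negPf uu') !(sedge_sym _ _ b') bb'_edge ub' wb'.
rewrite bu' (sedge_sym _ _ b w) wb => /(_ isT isT isT isT isT isT isT) /=.
rewrite !(adj_sym _ _ u') !(adj_sym _ b) (blocking_adj_opp bl' wb').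
by rewrite (blocking_adj_opp bl wb) (negPf ub) (negPf u'b').
Qed.

(** * Non-neighbours of an unbeaten vertex *)

Definition far w c := (c != w) && ~~ adj G w c.

Lemma blocking_far_edge s w u u' c : unbeaten w -> blocking s w u u' ->
  far w c -> adj G u c -> e s u c.
Proof. by move=> top [wu _ _ _] /andP[_ wc]; apply: unbeaten_far_edge wc. Qed.

(** Otherwise [w], [u], [c], [u'] would be an induced four-cycle of sign s. *)
Lemma blocking_far_notboth s w u u' c : unbeaten w -> blocking s w u u' ->
  far w c -> adj G u c -> ~~ adj G u' c.
Proof.
move=> top bl wc uc; apply/negP=> u'c.
have uc_s := blocking_far_edge top bl wc uc.
have := blocking_far_edge top (blocking_sym bl) wc u'c.
case: bl => wu wu' neq_uu' uu'; case/andP: wc => cw wc.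
rewrite sedge_sym => cu'; rewrite sedge_sym in wu'.
have := free_cycle4 freeG _ neq_uu' wu uc_s cu' wu'.
by rewrite eq_sym (negPf wc) (negPf uu') => /(_ cw).
Qed.

Lemma blocking_far_cover s w u u' c : blocking s w u u' ->
  far w c -> adj G u c || adj G u' c.
Proof.
case=> wu wu' neq_uu' uu' /andP[cw wc]; apply: contraT.
rewrite negb_or => /andP[uc u'c]; exfalso.
have ne v : e s w v -> v != c.
  by move=> /sedge_adj wv; apply: contraNneq wc => <-.
by apply: (@nonadj3 u u' c) => //; exact: ne.
Qed.

(** If both fail, some far [c] sees only [u] and some far [c'] only [u']. They are adjacent, being
    nonadjacent to [w]. Sign s gives the induced five-cycle [w], [u], [c], [c'], [u']; sign -s makes
    [u] and [u'] adjacent by (C2). *)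
Lemma blocking_far s w u u' : unbeaten w -> blocking s w u u' ->
  (forall c, far w c -> e s u c /\ ~~ adj G u' c) \/
  (forall c, far w c -> e s u' c /\ ~~ adj G u c).
Proof.
move=> top bl; have bl' := blocking_sym bl.
have [/forallP h|] := boolP [forall c, far w c ==> adj G u c].
  left=> c wc; have uc := implyP (h c) wc.
  by split; [apply: (blocking_far_edge top bl) | apply: (blocking_far_notboth top bl)].
rewrite negb_forall => /existsP[c']; rewrite negb_imply => /andP[wc' uc'].
have u'c' : adj G u' c' by move: (blocking_far_cover bl wc'); rewrite (negPf uc').
right=> c wc; have [uc|uc] := boolP (adj G u c); last first.
  split=> //; apply: (blocking_far_edge top bl') => //.
  by move: (blocking_far_cover bl wc); rewrite (negPf uc).
exfalso; have u'c := blocking_far_notboth top bl wc uc.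
have uc_s := blocking_far_edge top bl wc uc.
have u'c'_s := blocking_far_edge top bl' wc' u'c'.
case: (bl) => wu wu' neq_uu' uu'.
case/andP: wc wc' => cw wc /andP[cw' wc'].
have cc' : c != c' by apply: contraNneq uc' => <-.
have : adj G c c'.
  apply: contraT => ncc'; exfalso.
  by apply: (@nonadj3 c c' w) => //; rewrite adj_sym.
rewrite (adjE _ s) => /orP[cc'_s|cc'_s].
  rewrite sedge_sym in u'c'_s; rewrite sedge_sym in wu'.
  have := free_cycle5 freeG wu uc_s cc'_s u'c'_s wu'.
  by rewrite (negPf wc) (negPf wc') (negPf uc') (negPf uu') adj_sym (negPf u'c).
rewrite sedge_sym in u'c'_s.
by have [/sedge_adj] := C2_path uc_s cc'_s u'c'_s neq_uu'; rewrite (negPf uu').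
Qed.

(** A blocking pair oriented so that [u] sees every far vertex and [u'] sees none. *)
Definition pendant s w u u' :=
  blocking s w u u' /\ forall c, far w c -> e s u c /\ ~~ adj G u' c.

Lemma blocking_pendant s w u u' : unbeaten w -> blocking s w u u' ->
  pendant s w u u' \/ pendant s w u' u.
Proof.
by move=> top bl; case: (blocking_far top bl) => h; [left | right];
  split=> //; apply: blocking_sym.
Qed.

Definition closed_nbhd x := [set y | (y == x) || adj G x y].

Lemma pendant_closed_nbhd s w u u' :
  pendant s w u u' -> closed_nbhd u' \proper closed_nbhd w.
Proof.
case=> -[wu wu' neq_uu' uu'] farP; apply/properP; split.
  apply/subsetP=> y; rewrite !inE => /orP[/eqP->|u'y].
    by rewrite (sedge_adj wu') orbT.
  apply: contraTT u'y; rewrite negb_or => wy.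
  by have [] := farP y wy.
exists u; first by rewrite inE (sedge_adj wu) orbT.
by rewrite inE (negPf neq_uu') adj_sym (negPf uu').
Qed.

(** Every neighbour of [u'] other than [w] is a neighbour of [w], so unbeatenness passes from [w] to
    [u']: for the sign s through (C2), for -s because the vertex [z] is a (-s)-neighbour of [w]. *)
Lemma pendant_unbeaten s w u u' : unbeaten w -> pendant s w u u' ->
  (forall b, e (~~ s) w b -> e (~~ s) u' b) -> unbeaten u'.
Proof.
move=> top [bl farP] sub; have bl' := blocking_sym bl.
have [wu wu' neq_uu' uu'] := bl.
have near y : adj G u' y -> y = w \/ adj G w y.
  move=> u'y; have [->|yw] := eqVneq y w; [by left | right].
  apply: contraT => wy; have [|_] := farP y; first by rewrite /far yw.
  by rewrite u'y.
apply/unbeatenP=> t y z u'y yz.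
have [Et|/negPf Et] := eqVneq t s.
  rewrite {}Et in u'y yz *.
  have wy : e (~~ s) w y by apply: (unbeaten_closed top wu').
  have wz : e s w z by rewrite -(negbK s); apply: (unbeaten_closed top wy); rewrite negbK.
  have u'w : e s u' w by rewrite sedge_sym.
  have zy : e s z y by rewrite sedge_sym.
  have yu' : e (~~ s) y u' by rewrite sedge_sym.
  have zw : z != w by rewrite eq_sym (sedge_neq wz).
  have [_ []] := C2_path zy yu' u'w zw; first by rewrite sedge_sym.
  by move=> /sedge_opp; rewrite sedge_sym wy.
have {}Et : t = ~~ s by case: (t) (s) Et => -[].
rewrite {}Et negbK in u'y yz *; apply: sub.
case: (near _ (sedge_adj u'y)) => [<- //|]; rewrite (adjE _ s) => /orP[|] wy.
  exact: (unbeaten_closed top wy).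
by move: (blocking_opp bl' wy); rewrite u'y.
Qed.

(** (E2) holds at an unbeaten vertex, and (E1) cannot fail there through an edge [uv] of the
    opposite sign; only a blocking pair remains. *)
Lemma pendant_or_simplicial w : unbeaten w ->
  (exists s u u', pendant s w u u') \/ signed_simplicial G w.
Proof.
move=> top; have [/existsP[s] /existsP[u] /existsP[u'] /and4P bl|nobl] := boolP
    [exists s, exists u, exists u', [&& e s w u, e s w u', u != u' & ~~ adj G u u']].
  by left; case: (blocking_pendant top bl) => ?; [exists s, u, u' | exists s, u', u].
right=> s u v uv uw; split=> [uw_s wv|uv_s vw]; last first.
  rewrite sedge_sym -(negbK s); apply: (unbeaten_closed top (y := v)).
    by rewrite sedge_sym.
  by rewrite negbK sedge_sym.
have wu : e s w u by rewrite sedge_sym.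
have : adj G u v.
  apply: contraR nobl => nuv; apply/existsP; exists s; apply/existsP; exists u.
  by apply/existsP; exists v; rewrite wu wv uv.
rewrite (adjE _ s) => /orP[//|uv_opp].
by move: (unbeaten_closed top wu uv_opp); rewrite (sedge_opp wv).
Qed.

(** * Joins between (-s)-neighbours and non-neighbours of w *)

Section DoubleBlock.

Variables (s : bool) (w u u' : V).
Hypotheses (w_top : unbeaten w) (pend : pendant s w u u').
Hypothesis u_sup : forall b, e (~~ s) w b -> e (~~ s) u b.
Variable b0 : V.
Hypotheses (wb0 : e (~~ s) w b0) (u'b0 : ~~ e (~~ s) u' b0).

Let bl : blocking s w u u' := pend.1.
Let bl' : blocking s w u' u := blocking_sym bl.

(** Both [b] and [c] are nonadjacent to [u'], hence adjacent to each other; the sign is forced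
    because [w] is unbeaten. *)
Lemma missed_far_edge b c :
  e (~~ s) w b -> ~~ e (~~ s) u' b -> far w c -> e (~~ s) b c.
Proof.
move=> wb u'b wc; have [_ u'c] := pend.2 c wc.
have nu'b : ~~ adj G u' b by rewrite (blocking_adj_opp bl' wb).
case/andP: wc => _ wc; apply: (unbeaten_far_edge w_top) => //.
have ne v : adj G w v -> v != c by move=> wv; apply: contraNneq wc => <-.
have wu' := let: And4 _ wu' _ _ := bl in wu'.
apply: (free_alpha freeG (y := u')) => //; last by rewrite adj_sym.
- by rewrite eq_sym; apply: (@sedge_opp_neq _ G s _ _ w); rewrite sedge_sym.
- by apply: ne; apply: sedge_adj wu'.
- by apply: ne; apply: sedge_adj wb.
Qed.

(* Otherwise u', w, u, c together with b and b0 form a hill with six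
   vertices. *)
Lemma opp_far_edge b c : e (~~ s) w b -> far w c -> e (~~ s) b c.
Proof.
move=> wb wc; have [u'b|u'b] := boolP (e (~~ s) u' b); last exact: missed_far_edge.
case/andP: (wc) => cw nwc; apply: (unbeaten_far_edge w_top) => //.
apply: contraT => bc; exfalso.
have [wu wu' neq_uu' uu'] := bl; have [uc u'c] := pend.2 c wc.
have u'w : e s u' w by rewrite sedge_sym.
have bb0 : b != b0 by apply: contraTneq u'b => ->.
have bu' : e (~~ s) b u' by rewrite sedge_sym.
have u'w2 : e (~~ ~~ s) u' w by rewrite negbK.
have [bb0_edge _] := C2_path bu' u'w2 wb0 bb0.
(* The path [u'], [w], [u], [c] has sign s; [b] and [b0] are the two vertices joined to it by
   (-s)-edges. *)
have := @free_hill6 _ _ freeG (~~ s) u' w u c b b0.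
rewrite negbK u'w wu uc bb0_edge bu' !(sedge_sym _ _ _ w) wb wb0.
rewrite !(sedge_sym _ _ _ u) !u_sup // missed_far_edge //.
move=> /(_ isT isT isT isT isT isT isT isT isT isT).
rewrite adj_sym (negPf uu') (negPf u'c) (negPf nwc) (negPf bc) adj_sym.
by rewrite (blocking_adj_opp bl' wb0) (negPf u'b0).
Qed.

(** Suppose [y] is adjacent to [w]. If [wy] has sign s, the witness [z] is a (-s)-neighbour of [w],
    hence (-s)-joined to [x]. If it has sign -s, nestedness makes [yu] an s-edge, against
    [u_sup]. *)
Lemma far_up t x y : far w x -> beaten t x y -> far w y.
Proof.
move=> wx xy; have [xyE [z yz xz]] := beatenP _ _ _ xy.
have [ux u'x] := pend.2 x wx; have [wu wu' neq_uu' uu'] := bl.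
have xu : e s x u by rewrite sedge_sym.
case/andP: (wx) => neq_xw nwx; rewrite /far.
have neq_yw : y != w.
  by apply: contraNneq nwx => <-; rewrite adj_sym (sedge_adj xyE).
rewrite neq_yw /=; apply/negP; rewrite (adjE _ s) => /orP[] wy.
  have := unbeaten_far_edge w_top wy nwx; rewrite adj_sym (sedge_adj xyE).
  rewrite sedge_sym => /(_ isT) xy_s.
  have Et : t = ~~ s.
    by apply/eqP; case: eqP xyE => // /eqP; case: (t) (s) xy_s => -[] //= /sedge_opp ->.
  rewrite Et in yz xz; case/negP: xz.
  by rewrite sedge_sym opp_far_edge // (unbeaten_closed w_top wy).
have := unbeaten_far_edge w_top wy nwx; rewrite adj_sym (sedge_adj xyE).
rewrite sedge_sym => /(_ isT) xy_opp.
have Et : t = s.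
  by apply/eqP; case: eqP xyE => // /eqP; case: (t) (s) xy_opp => -[] //= /sedge_opp ->.
rewrite Et in xy; have := beaten_nested xy xu.
by rewrite sedge_sym => /sedge_opp; rewrite u_sup.
Qed.

(** From [z], the vertex [w] is far, so it is joined to [y] but not to [y']. *)
Lemma far_unbeaten_shrinks z : far w z -> unbeaten z ->
  forall t y y', pendant t z y y' ->
  [/\ far w y', unbeaten y' & closed_nbhd y' \proper closed_nbhd z].
Proof.
move=> wz ztop t y y' pz; case: (pz) => bz farz.
have [zy zy' neq_yy' yy'] := bz; case/andP: (wz) => neq_zw nwz.
have [yw y'w] : e t y w /\ ~~ adj G y' w.
  by apply: farz; rewrite /far eq_sym neq_zw adj_sym.
have wy' : far w y'.
  rewrite /far adj_sym y'w andbT; apply: contraNneq nwz => <-.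
  by rewrite adj_sym (sedge_adj zy').
split=> //; last exact: pendant_closed_nbhd pz.
(* Otherwise [y] is a (-s)-neighbour of [w], hence joined to the far vertex [y']. *)
have Et : t = s.
  apply/eqP; apply: contraT => /negPf ts.
  have {}ts : t = ~~ s by case: (t) (s) ts => -[].
  case/negP: yy'; apply: (sedge_adj (s := ~~ s)); apply: opp_far_edge => //.
  by rewrite sedge_sym -ts.
rewrite Et in bz zy yw pz; apply: (pendant_unbeaten ztop pz) => b zb.
have wy : e s w y by rewrite sedge_sym.
have [yb|//] := orP (blocking_cover bz zb).
by rewrite sedge_sym opp_far_edge // (unbeaten_closed w_top wy).
Qed.

End DoubleBlock.

(** * Existence of a vertex that can come last *)

Lemma simplicial_exists (x0 : V) : exists w, signed_simplicial G w.
Proof.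
have [x _ x_top] := @unbeaten_exists predT x0 isT (fun _ _ _ _ _ => isT).
case: (arg_minnP (fun x => #|closed_nbhd x|) x_top) => w w_top minw.
have [[s [u [u' pend]]]|] := pendant_or_simplicial w_top; last by exists w.
(* Otherwise [v'] would be unbeaten with a smaller closed neighbourhood than [w]. *)
have not_sup v v' : pendant s w v v' -> ~ (forall b, e (~~ s) w b -> e (~~ s) v' b).
  move=> pv sup; have := proper_card (pendant_closed_nbhd pv).
  by rewrite ltnNge minw //; apply: (pendant_unbeaten w_top pv).
have u_sup b : e (~~ s) w b -> e (~~ s) u b.
  by move: b; case: (blocking_nested pend.1) => // /(not_sup _ _ pend).
have [b0 wb0 u'b0] : exists2 b, e (~~ s) w b & ~~ e (~~ s) u' b.
  have [/forallP sup|] := boolP [forall b, e (~~ s) w b ==> e (~~ s) u' b].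
    by case: (not_sup _ _ pend) => b; apply/implyP.
  by rewrite negb_forall => /existsP[b]; rewrite negb_imply => /andP[]; exists b.
(* Without far vertices the pair is pendant in either order, and [u_sup] contradicts [not_sup] for
   the exchanged pair. *)
case: (pickP (far w)) => [c wc|no_far]; last first.
  case: (not_sup u' u) => //; split; first exact: blocking_sym pend.1.
  by move=> c; rewrite no_far.
have [z1 wz1 z1_top] := unbeaten_exists wc (far_up w_top pend u_sup wb0 u'b0).
have Dz1 : [pred z | far w z & unbeaten z] z1 by rewrite /= wz1.
(* A pendant pair at this [z] would give a far unbeaten vertex with a smaller closed
   neighbourhood. *)
case: (arg_minnP (fun x => #|closed_nbhd x|) Dz1) => z /= /andP[wz z_top] minz.
have [[t [y [y' pz]]]|] := pendant_or_simplicial z_top; last by exists z.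
have [wy' y'_top] := far_unbeaten_shrinks w_top pend u_sup wb0 u'b0 wz z_top pz.
by move=> /proper_card; rewrite ltnNge minz // wy'.
Qed.

End Simplicial.

(** * From (I1) and (I2) to forced adjacencies *)

Section FromConditions.

Variables (V : finType) (G : signed_graph V).
Local Notation e := (sedge G).

Lemma neq_eqF (T : eqType) (x y : T) : x != y -> ((x == y) = false) * ((y == x) = false).
Proof. by move=> xy; rewrite (negPf xy) eq_sym (negPf xy). Qed.

Lemma nonadj_F x y : ~~ adj G x y -> (adj G x y = false) * (adj G y x = false).
Proof. by move=> xy; rewrite (negPf xy) adj_sym (negPf xy). Qed.

Lemma cond_I1_cycle4 s a b c d : cond_I1 G -> a != c -> b != d ->
  e s a b -> e s b c -> e s c d -> e s d a -> adj G a c || adj G b d.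
Proof.
move=> I1 ac bd ab bc cd da; apply: contraT; rewrite negb_or => /andP[nac nbd].
case: (I1 s [:: a; b; c; d]); first by left.
have E := (neq_eqF ac, neq_eqF bd, neq_eqF (sedge_neq ab), neq_eqF (sedge_neq bc),
  neq_eqF (sedge_neq cd), neq_eqF (sedge_neq da)).
have N := (adj_irr G, nonadj_F nac, nonadj_F nbd).
split=> //; [by rewrite /= !inE !E | by rewrite /= ab bc cd da |].
by move=> x y; rewrite !inE => /or4P[] /eqP-> /or4P[] /eqP->;
  rewrite ?N //= !(E, eqxx); auto.
Qed.

Lemma cond_I1_cycle5 s a b c d f : cond_I1 G ->
    e s a b -> e s b c -> e s c d -> e s d f -> e s f a ->
  [|| adj G a c, adj G a d, adj G b d, adj G b f | adj G c f].
Proof.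
move=> I1 ab bc cd df fa; apply: contraT.
case/norP=> nac /norP[nad /norP[nbd /norP[nbf ncf]]].
case: (I1 s [:: a; b; c; d; f]); first by right.
(* Vertices of the five-cycle are separated by a third one adjacent to exactly one of them. *)
have ne x y z : adj G z x -> ~~ adj G z y -> x != y.
  by move=> zx; apply: contraNneq => <-.
have [ba cb] : adj G b a /\ adj G c b.
  by split; rewrite adj_sym ?(sedge_adj ab) ?(sedge_adj bc).
have nfc : ~~ adj G f c by rewrite adj_sym.
have E := (neq_eqF (sedge_neq ab), neq_eqF (sedge_neq bc),
  neq_eqF (sedge_neq cd), neq_eqF (sedge_neq df), neq_eqF (sedge_neq fa),
  (neq_eqF (ne _ _ _ (sedge_adj fa) nfc), neq_eqF (ne _ _ _ ba nbd),
  neq_eqF (ne _ _ _ (sedge_adj ab) nad), neq_eqF (ne _ _ _ cb ncf),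
  neq_eqF (ne _ _ _ (sedge_adj bc) nbf))).
have N := (adj_irr G, nonadj_F nac, nonadj_F nad, nonadj_F nbd, nonadj_F nbf,
  nonadj_F ncf).
split=> //; [by rewrite /= !inE !E | by rewrite /= ab bc cd df fa |].
by move=> x y; rewrite !inE => /orP[/eqP->|/or4P[]/eqP->] /orP[/eqP->|/or4P[]/eqP->];
  rewrite ?N //= !(E, eqxx); auto.
Qed.

(** A hill inside [G] with its path given as a list, so that concrete lists can be checked by case
    analysis. All indices are in range, so the default [w1] is never read. *)
Definition is_hill_seq s w1 w2 (l : seq V) :=
  let v := nth w1 l in let n := size l in
  [/\ 2 <= n, uniq [:: w1, w2 & l],
      [/\ forall i, i.+1 < n -> e (~~ s) (v i) (v i.+1), e s w1 w2,
          forall i, i.+1 < n -> e s w1 (v i) &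
          forall i, 0 < i < n -> e s w2 (v i)] &
      [/\ forall i j, i.+1 < j < n -> ~~ adj G (v i) (v j),
          ~~ adj G w1 (v n.-1) & ~~ adj G w2 (v 0)]].

Lemma cond_I2_hill_seq s w1 w2 l : cond_I2 G ->
  size l = 3 \/ size l = 4 -> ~ is_hill_seq s w1 w2 l.
Proof.
move=> I2 sz [n2 ul [path_v w12 w1v w2v] [nv nw1 nw2]].
pose S := [set x in [:: w1, w2 & l]].
have cardS : #|S| = (size l).+2 by rewrite cardsE; apply/card_uniqP.
case: (I2 S); first by rewrite cardS; case: sz => ->; auto.
have inS x : x \in [:: w1, w2 & l] -> x \in S by rewrite in_set.
have w1S : w1 \in S by rewrite !inE eqxx.
have w2S : w2 \in S by rewrite !inE eqxx orbT.
have vS (i : 'I_(size l)) : nth w1 l i \in S.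
  by apply: inS; rewrite !inE mem_nth ?orbT.
pose w1' : {x | x \in S} := Sub w1 w1S; pose w2' : {x | x \in S} := Sub w2 w2S.
pose v (i : 'I_(size l)) : {x | x \in S} := Sub (nth w1 l i) (vS i).
(* Distinctness and coverage in the induced subgraph are read off the list in [V], since [val] is
   injective. *)
have valE : [seq val x | x <- [:: w1', w2' & [seq v i | i <- enum 'I_(size l)]]]
    = [:: w1, w2 & l].
  rewrite /= -map_comp; congr [:: _, _ & _].
  rewrite -[RHS](mkseq_nth w1) /mkseq -val_enum_ord -map_comp.
  exact: eq_map.
exists s, (size l), v, w1', w2'; split=> //.
- split; first by rewrite -(map_inj_uniq val_inj) valE.
  by move=> x; rewrite -(mem_map val_inj) valE; have := valP x; rewrite inE.
- split=> [i j Eij||i|i i0]; rewrite /= /induced_edge //=.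
  + by rewrite Eij; apply: path_v; rewrite -Eij.
  + exact: w1v.
  + by apply: w2v; rewrite i0 /=.
- split=> [i j ij|i Ei|i Ei].
  + by apply: nv; rewrite ij /=.
  + by move: nw1; rewrite -Ei.
  + by move: nw2; rewrite -Ei.
Qed.

Lemma cond_I2_hill5 s v1 v2 v3 w1 w2 : cond_I2 G ->
  e (~~ s) v1 v2 -> e (~~ s) v2 v3 -> e s w1 w2 ->
  e s w1 v1 -> e s w1 v2 -> e s w2 v2 -> e s w2 v3 ->
  [|| adj G v1 v3, adj G w1 v3 | adj G w2 v1].
Proof.
move=> I2 v12 v23 w12 w11 w1_2 w22 w23; apply: contraT.
case/norP=> n13 /norP[nw1 nw2].
case: (@cond_I2_hill_seq s w1 w2 [:: v1; v2; v3] I2); first by left.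
have w13 : w1 != v3 by apply: sedge_opp_neq w1_2 _; rewrite sedge_sym.
have w21 : w2 != v1 by apply: sedge_opp_neq w22 v12.
have v13 : v1 != v3 by apply: contraNneq nw1 => <-; apply: sedge_adj w11.
split=> //.
- by rewrite /= !inE !negb_or (sedge_neq w12) (sedge_neq w11) (sedge_neq w1_2) w13
    w21 (sedge_neq w22) (sedge_neq w23) (sedge_neq v12) v13 (sedge_neq v23).
- by split=> // -[|[|[|]]] //=.
- by split=> // i [|[|[|j]]] /andP[] // ij _; case: i ij => [|[|[|i]]].
Qed.

Lemma cond_I2_hill6 s v1 v2 v3 v4 w1 w2 : cond_I2 G ->
  e (~~ s) v1 v2 -> e (~~ s) v2 v3 -> e (~~ s) v3 v4 -> e s w1 w2 ->
  e s w1 v1 -> e s w1 v2 -> e s w1 v3 -> e s w2 v2 -> e s w2 v3 -> e s w2 v4 ->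
  [|| adj G v1 v3, adj G v1 v4, adj G v2 v4, adj G w1 v4 | adj G w2 v1].
Proof.
move=> I2 v12 v23 v34 w12 w11 w1_2 w13 w22 w23 w24; apply: contraT.
case/norP=> n13 /norP[n14 /norP[n24 /norP[nw1 nw2]]].
case: (@cond_I2_hill_seq s w1 w2 [:: v1; v2; v3; v4] I2); first by right.
have w14 : w1 != v4 by apply: sedge_opp_neq w13 _; rewrite sedge_sym.
have w21 : w2 != v1 by apply: sedge_opp_neq w22 v12.
have v13 : v1 != v3.
  by apply: contraNneq n14 => ->; apply: sedge_adj v34.
have v14 : v1 != v4 by apply: contraNneq nw1 => <-; apply: sedge_adj w11.
have v24 : v2 != v4 by apply: contraNneq nw1 => <-; apply: sedge_adj w1_2.
split=> //.
- by rewrite /= !inE !negb_or (sedge_neq w12) (sedge_neq w11) (sedge_neq w1_2)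
    (sedge_neq w13) w14 w21 (sedge_neq w22) (sedge_neq w23) (sedge_neq w24)
    (sedge_neq v12) v13 v14 (sedge_neq v23) v24 (sedge_neq v34).
- by split=> // -[|[|[|[|]]]] //=.
- by split=> // i [|[|[|[|j]]]] /andP[] // ij _; case: i ij => [|[|[|[|i]]]].
Qed.

End FromConditions.

Lemma conditions_obstruction_free (V : finType) (G : signed_graph V) :
  no_independent_triple G -> cond_C2 G -> cond_I1 G -> cond_I2 G ->
  obstruction_free G.
Proof.
move=> alpha C2 I1 I2; split=> //.
- move=> x y z xy yz xz nxy nyz; apply: contraT => nxz.
  by case: alpha; exists x, y, z; split; rewrite //= !inE negb_or xy xz yz.
- by move=> s a b c d; apply: cond_I1_cycle4.
- by move=> s a b c d f; apply: cond_I1_cycle5.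
- by move=> s v1 v2 v3 w1 w2; apply: cond_I2_hill5.
- by move=> s v1 v2 v3 v4 w1 w2; apply: cond_I2_hill6.
Qed.

(** * Heredity and construction of the ordering *)

Lemma induced_obstruction_free (V : finType) (G : signed_graph V) (S : {set V}) :
  obstruction_free G -> obstruction_free (induced G S).
Proof.
case=> alpha C2 c4 c5 h5 h6; split=> //.
- by move=> x y z xy yz xz; apply: (alpha (val x) (val y) (val z)).
- move=> s u v w x ux; apply: (C2 s (val u) (val v) (val w) (val x)).
  by rewrite -(map_inj_uniq val_inj) in ux.
- by move=> s a b c d; apply: (c4 s (val a) (val b) (val c) (val d)).
- by move=> s a b c d f; apply: (c5 s (val a) (val b) (val c) (val d) (val f)).
- by move=> s v1 v2 v3 w1 w2;
    apply: (h5 s (val v1) (val v2) (val v3) (val w1) (val w2)).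
- by move=> s v1 v2 v3 v4 w1 w2;
    apply: (h6 s (val v1) (val v2) (val v3) (val v4) (val w1) (val w2)).
Qed.

Definition elimination_step (V : finType) (G : signed_graph V) (u v w : V) :=
  forall s,
    (sedge G s u w -> sedge G s w v -> sedge G s u v) /\
    (sedge G s u v -> sedge G (~~ s) v w -> sedge G s u w).

(** Induction over subsets of the fixed type [V]: a simplicial vertex of the subgraph induced on [S]
    is removed and then ranked last, with value [n]. *)
Lemma elimination_rank (V : finType) (G : signed_graph V) :
  obstruction_free G -> forall n (S : {set V}), #|S| = n ->
  exists f : V -> nat, [/\ {in S, forall x, f x < n}, {in S &, injective f} &
    {in S & &, forall u v w, u != v -> f u < f w -> f v < f w ->
       elimination_step G u v w}].
Proof.
move=> freeG; elim=> [|n IHn] S cardS.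
  by exists (fun=> 0); split=> [x|x y|u v w]; rewrite (cards0_eq cardS) inE.
have [x0 Sx0] : exists x, x \in S by apply/card_gt0P; rewrite cardS.
have [[w0 Sw0] w0_simpl] :=
  simplicial_exists (induced_obstruction_free S freeG) (Sub x0 Sx0).
have [|f [f_lt f_inj f_elim]] := IHn (S :\ w0).
  by apply/eqP; rewrite -eqSS -cardS (cardsD1 w0 S) Sw0.
have inS' y : y \in S -> y != w0 -> y \in S :\ w0 by move=> Sy yw; rewrite !inE yw.
exists (fun y => if y == w0 then n else f y); split.
- by move=> x Sx; case: eqVneq => // xw; apply: ltnW; apply/f_lt/inS'.
- move=> x y Sx Sy; case: (eqVneq x w0) => [->|xw]; case: (eqVneq y w0) => [->|yw] //.
  + by move=> E; have := f_lt y (inS' y Sy yw); rewrite -E ltnn.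
  + by move=> E; have := f_lt x (inS' x Sx xw); rewrite E ltnn.
  + by apply: f_inj; apply: inS'.
move=> u v w Su Sv Sw uv; case: (eqVneq w w0) => [->|ww].
  case: (eqVneq u w0) => [_|uw]; first by rewrite ltnn.
  move=> _ _ s.
  exact: (w0_simpl s (Sub u Su) (Sub v Sv)).
case: (eqVneq u w0) => [_|uw].
  by have := f_lt w (inS' w Sw ww) => fw fu; have := ltn_trans fw fu; rewrite ltnn.
case: (eqVneq v w0) => [_|vw].
  by have := f_lt w (inS' w Sw ww) => fw _ fv; have := ltn_trans fw fv; rewrite ltnn.
by apply: f_elim => //; apply: inS'.
Qed.

Lemma obstruction_free_eliminable (V : finType) (G : signed_graph V) :
  obstruction_free G -> signed_eliminable G.
Proof.
move=> freeG; have [f [f_lt f_inj f_elim]] := elimination_rank freeG (cardsT V).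
have {}f_lt x : f x < #|V| by apply: f_lt.
exists (fun x => Ordinal (f_lt x)); split.
  apply: inj_card_bij; last by rewrite card_ord.
  by move=> x y [] /f_inj; apply.
move=> u v w; rewrite /= !inE negb_or => /andP[/andP[uv _] _] uw vw.
by apply: f_elim.
Qed.

(** * Eliminable graphs satisfy the conditions *)

Section Eliminable.

Variables (V : finType) (G : signed_graph V) (f : V -> nat).
Hypothesis f_inj : injective f.
Hypothesis f_elim : forall u v w, uniq [:: u; v; w] -> f u < f w -> f v < f w ->
  elimination_step G u v w.
Local Notation e := (sedge G).

Definition last_in (c : seq V) x := {in c, forall y, f y <= f x}.

Lemma last_in_exists x0 c : x0 \in c -> exists2 x, x \in c & last_in c x.
Proof.
move=> cx0; case: (@arg_maxnP _ x0 (mem c) f cx0) => x cx maxx.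
by exists x => // y; apply: maxx.
Qed.

Lemma last_in_lt c x y : last_in c x -> y \in c -> y != x -> f y < f x.
Proof.
by move=> lastx cy yx; rewrite ltn_neqAle lastx // andbT (inj_eq f_inj).
Qed.

Lemma last_E1 c s u v w : last_in c w -> u \in c -> v \in c -> u != v ->
  e s u w -> e s w v -> e s u v.
Proof.
move=> lastw cu cv uv uw wv; have vw : v != w by rewrite eq_sym (sedge_neq wv).
have uniq3 : uniq [:: u; v; w] by rewrite /= !inE negb_or uv (sedge_neq uw) vw.
have [||E1 _] := f_elim uniq3 _ _ s; last exact: E1.
- exact: last_in_lt lastw cu (sedge_neq uw).
- exact: last_in_lt lastw cv vw.
Qed.

Lemma last_E2 c s u v w : last_in c w -> u \in c -> v \in c -> u != w ->
  e s u v -> e (~~ s) v w -> e s u w.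
Proof.
move=> lastw cu cv uw uv vw.
have uniq3 : uniq [:: u; v; w].
  by rewrite /= !inE negb_or uw (sedge_neq uv) (sedge_neq vw).
have [||_ E2] := f_elim uniq3 _ _ s; last exact: E2.
- exact: last_in_lt lastw cu uw.
- exact: last_in_lt lastw cv (sedge_neq vw).
Qed.

Lemma eliminable_C2 : cond_C2 G.
Proof.
(* When [u] or [v] comes last, the second alternative of (C2) holds; reversing the path turns the
   remaining cases into these and yields the first. *)
have half s u v w x y : uniq [:: u; v; w; x] ->
    last_in [:: u; v; w; x] y -> y = u \/ y = v ->
    e s u v -> e (~~ s) v w -> e s w x -> e s u x /\ e s v x.
  move=> uniq4 lasty; set c := [:: u; v; w; x] in uniq4 lasty.
  have [cu cv cw cx] : [/\ u \in c, v \in c, w \in c & x \in c].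
    by rewrite !inE !eqxx !orbT.
  move: uniq4; rewrite /= !inE !negb_or => /and4P[/and3P[uv uw ux] /andP[vw vx] wx _].
  case=> Ey uv_s vw_s wx_s; rewrite {y}Ey in lasty.
  - have wu : e (~~ s) w u.
      by apply: (last_E2 lasty cw cv); rewrite 1?eq_sym // sedge_sym ?negbK.
    have xu : e s x u.
      by apply: (last_E2 lasty cx cw) => //; rewrite 1?eq_sym // sedge_sym.
    split; first by rewrite sedge_sym.
    by rewrite sedge_sym; apply: (last_E1 lasty cx cv) => //; rewrite eq_sym.
  - have xv : e s x v.
      apply: (last_E2 lasty cx cw); [by rewrite eq_sym| |]; by rewrite sedge_sym.
    have vx_s : e s v x by rewrite sedge_sym.
    by split=> //; apply: (last_E1 lasty cu cx).
move=> s u v w x uniq4 uv vw wx.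
have [|y cy lasty] := @last_in_exists u [:: u; v; w; x]; first exact: mem_head.
have rev4 : [:: x; w; v; u] = rev [:: u; v; w; x] by [].
have uniq4' : uniq [:: x; w; v; u] by rewrite rev4 rev_uniq.
have lasty' : last_in [:: x; w; v; u] y.
  by move=> z; rewrite rev4 mem_rev; apply: lasty.
have [Ey|Ey] : (y = u \/ y = v) \/ (y = x \/ y = w).
- by move: cy; rewrite !inE => /or4P[] /eqP; auto.
- by right; apply: half lasty Ey uv vw wx.
rewrite sedge_sym in uv; rewrite sedge_sym in vw; rewrite sedge_sym in wx.
have [xu wu] := half s x w v u y uniq4' lasty' Ey wx vw uv.
by left; split; rewrite sedge_sym.
Qed.

(** By (E1) the two cycle neighbours of the last vertex are adjacent, which is a chord. *)
Lemma eliminable_I1 : cond_I1 G.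
Proof.
move=> s c sz [_ uc cyc ind].
have [x0 cx0] : exists x, x \in c.
  by case: c sz {uc cyc ind} => [[]|x c _] //; exists x; apply: mem_head.
have [x cx lastx] := last_in_exists cx0.
have [i p rot_c] := rot_to cx.
have memp y : (y \in x :: p) = (y \in c) by rewrite -rot_c mem_rot.
have lastp : last_in (x :: p) x by move=> y; rewrite memp; apply: lastx.
have up : uniq (x :: p) by rewrite -rot_c rot_uniq.
have cycp : cycle (e s) (x :: p) by rewrite -rot_c rot_cycle.
have indp y z : y \in x :: p -> z \in x :: p -> adj G y z ->
    z = next (x :: p) y \/ y = next (x :: p) z.
  by rewrite !memp -rot_c !next_rot //; apply: ind.
have szp : size (x :: p) = 4 \/ size (x :: p) = 5 by rewrite -rot_c size_rot.
case: p up cycp indp szp lastp {memp rot_c} => [|y [|m q]]; try by move=> ? ? ? [].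
case/lastP: q => [|r z]; first by move=> ? ? ? [].
move=> up cycp indp _ lastp.
move: cycp; rewrite (cycle_path x) => /and3P[zx xy _].
have rot_c : rotr 1 [:: x, y, m & rcons r z] = [:: z, x, y, m & r].
  by rewrite -!rcons_cons rotr1_rcons.
have uz : uniq [:: z, x, y, m & r] by rewrite -rot_c rotr_uniq.
have zin : z \in [:: x, y, m & rcons r z] by rewrite !inE mem_rcons mem_head !orbT.
have yin : y \in [:: x, y, m & rcons r z] by rewrite !inE eqxx !orbT.
move: (uz) => /=; rewrite !inE !negb_or.
move=> /and4P[/and4P[neq_zx neq_zy neq_zm _] /and3P[neq_xy _ _] _ _].
have neq_yz : y != z by rewrite eq_sym.
have yx : e s y x by rewrite sedge_sym.
move: zx; rewrite sedge_sym /= last_rcons => xz.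
have yz := last_E1 lastp yin zin neq_yz yx xz.
(* The list is [x], [y], [m], ..., [z], so [y] and [z] could be consecutive only if [z = m] or
   [y = x]. *)
case: (indp y z yin zin (sedge_adj yz)) => E.
  move: E; rewrite /= (eq_sym y) (negPf neq_xy) eqxx => E.
  by rewrite E eqxx in neq_zm.
by move: E; rewrite -(next_rotr 1) // rot_c /= !eqxx => E; rewrite E eqxx in neq_xy.
Qed.

(** Whichever vertex comes last, a missing edge is forced. (E1) gives [w2] to the first path vertex
    if [w1] is last, [w1] to the last path vertex if [w2] is last, and a chord of the path at an
    inner vertex; (E2) handles the two path ends. *)
Lemma eliminable_hill : ~ is_hill G.
Proof.
move=> [s [n [v [w1 [w2 [n2 [ul cover] [path_v w12 w1v w2v] [nv nw1 nw2]]]]]]].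
set l := [:: w1, w2 & _] in ul cover.
have [x _ lastx] := last_in_exists (cover w1).
have n_gt0 : 0 < n by apply: ltnW.
pose i0 := Ordinal n_gt0.
have n1_lt : n.-1 < n by rewrite prednK.
pose i1 := Ordinal n1_lt.
have lv i : v i \in [seq v i | i <- enum 'I_n] by rewrite map_f // mem_enum.
move: ul => /and3P[]; rewrite in_cons negb_or => /andP[_ w1l] w2l uv.
have wv1 i : w1 != v i by apply: contraNneq w1l => ->.
have wv2 i : w2 != v i by apply: contraNneq w2l => ->.
have v_inj : injective v by apply/injectiveP.
move: (cover x); rewrite !in_cons => /or3P[/eqP Ex|/eqP Ex|/mapP[i _ Ex]];
  rewrite {x}Ex in lastx.
- have w21 : e s w2 w1 by rewrite sedge_sym.
  have /sedge_adj := last_E1 lastx (cover _) (cover _) (wv2 i0) w21 (w1v i0 n2).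
  by apply/negP; apply: nw2.
- have := @last_E1 _ s _ _ _ lastx (cover w1) (cover (v i1)) (wv1 i1) w12.
  have i1_gt0 : 0 < i1 by rewrite /= -subn1 subn_gt0.
  by move=> /(_ (w2v _ i1_gt0))/sedge_adj; apply/negP/nw1; rewrite /= prednK.
have [Ei|i_gt0] := posnP i.
  pose j := Ordinal n2.
  have vji : e (~~ s) (v j) (v i) by rewrite sedge_sym path_v //= Ei.
  have /sedge_adj := last_E2 lastx (cover _) (cover _) (wv2 i) (w2v j isT) vji.
  by apply/negP/nw2.
have j_lt : i.-1 < n by apply: leq_ltn_trans (leq_pred i) _.
pose j := Ordinal j_lt.
have vji : e (~~ s) (v j) (v i) by rewrite path_v //= prednK.
have [i_lt|i_ge] := ltnP i.+1 n.
  pose k := Ordinal i_lt.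
  have vik : e (~~ s) (v i) (v k) by rewrite path_v.
  have jk : v j != v k.
    apply/eqP => /v_inj/(congr1 val) /= E.
    by move: (leq_pred i); rewrite E ltnn.
  have /sedge_adj := last_E1 lastx (cover _) (cover _) jk vji vik.
  by apply/negP/nv; rewrite /= prednK.
have Ei : i.+1 = n by apply/eqP; rewrite eqn_leq i_ge ltn_ord.
have w1j : e s w1 (v j) by apply: w1v; rewrite /= prednK.
have /sedge_adj := last_E2 lastx (cover _) (cover _) (wv1 i) w1j vji.
by apply/negP/nw1.
Qed.

End Eliminable.

Theorem proposition6p3 (V : finType) (G : signed_graph V)
    (alphaG : no_independent_triple G) :
  signed_eliminable G <-> cond_C2 G /\ cond_I1 G /\ cond_I2 G.
Proof.
split=> [[nu [/bij_inj nu_inj nu_elim]]|[C2 [I1 I2]]]; last first.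
  exact/obstruction_free_eliminable/conditions_obstruction_free.
pose f x : nat := nu x.
have f_inj : injective f by move=> x y /val_inj /nu_inj.
have f_elim u v w : uniq [:: u; v; w] -> f u < f w -> f v < f w ->
  elimination_step G u v w by apply: nu_elim.
split; first exact: (eliminable_C2 f_inj f_elim).
split; first exact: (eliminable_I1 f_inj f_elim).
move=> S _; apply: (@eliminable_hill _ (induced G S) (f \o val)).
  exact: inj_comp f_inj val_inj.
move=> u v w; rewrite -(map_inj_uniq val_inj) => uniq3 uw vw.
exact: (f_elim _ _ _ uniq3 uw vw).
Qed.
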